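(* Let $F$ be an algebraically closed field of characteristic $2$ and let $n=2m$ with $m$ even. If $D_1$ and $D_2$ are irreducible $F\Sigma_n$-modules of dimension greater than $1$, then $D_1\otimes D_2$ is not irreducible.
   Context: $\Sigma_n$ is the symmetric group on $n$ letters. The tensor product is over $F$ with the diagonal action of $\Sigma_n$. *)

(* Defs.v *)
From mathcomp Require Export all_boot all_algebra all_fingroup all_solvable all_field all_character.

Set Implicit Arguments.
Unset Strict Implicit.
Unset Printing Implicit Defensive.

(* Main.v *)
Require Import Defs.

Set Implicit Arguments.
Unset Strict Implicit.
Unset Printing Implicit Defensive.
Import GRing.Theory.
Local Open Scope ring_scope.

(** Write t_ij for the action of the transposition (i j) on a module, put
    n_ij = 1 + t_ij, so that n_ij^2 = 0, and suppose that D1 (x) D2 is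
    irreducible. By Schur's lemma every operator on D1 (x) D2 that commutes
    with the diagonal action of the symmetric group is a scalar. The proof
    writes down three such operators and reads off what their being scalar
    says about the factors.

    The first is the class sum of t_ij (x) t_ij. Its conjugates by g (x) 1 are
    the same scalar; adding them for g in the four-group generated by (a c)
    and (b e) gives zero on the scalar side, while on the other side
    characteristic 2 cancels everything except Q (x) Q, where
    Q = t_ab + t_bc + t_ce + t_ea ([four_cycle_ten]). So Q vanishes on one of
    the factors, say on D1. Then t_ab t_bc + t_bc t_ab is the same for all
    triples, hence a scalar; it is idempotent, and it is not 0 because D1 is
    not linear. It follows that t_ab + t_bc = t_ac ([spin_relations]): D1 is
    the basic spin module. For a fixed letter o the operators c_a = t_ao
    (with c_o = 0) satisfy the Clifford relations c_a c_b + c_b c_a = 1, and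
    t_ab = c_a + c_b. The sum of all c_a is a scalar with square C(n,2), which
    is even since n = 2m with m even; so that sum is zero ([sum_cliff0]).
    This is the point at which the parity of m matters.

    The second operator is the sum of t_ab (x) n_ab, and it forces the row sums
    of (n_ab) on D2 to be all equal ([row_sum_const]).

    The third is Theta = sum_(a < b) c_a c_b (x) n_ab + 1 (x) R. Reordering
    c_a c_b costs 1, so conjugation by g changes the double sum by 1 (x) z(g),
    where z(g) is the sum of n_ab over the pairs inverted by g. Such an R with
    g^-1 R g = R + z(g) exists on every irreducible module
    ([inversion_sum_coboundary]): g |-> g z(g) is a derivation into the matrix
    algebra, derivations with vanishing trace are inner
    ([traceless_derivation_inner]), and the trace of g z(g) is zero
    ([trace_inversion_sum]). This z is the cocycle of the Z/2-grading of the
    group algebra in which n_ij is odd for adjacent i and j.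

    Once Theta is a scalar, commuting it with c_k and then with c_l leaves
    n_ok + n_lo + n_lk = 0 on D2 ([theta_triangle]). Squaring shows that t_ko
    and t_lo commute, which makes the transpositions of D2 all equal and D2
    linear ([comm_transp_linear]). *)

(** * Sums over pairs of letters *)

Section PairSum.
Variables (n : nat) (V : zmodType).
Hypothesis ch2 : forall x : V, x + x = 0.
Implicit Types (f g : 'I_n -> 'I_n -> V).

Definition pair_sum (f : 'I_n -> 'I_n -> V) : V :=
  \sum_(p : 'I_n * 'I_n | (p.1 < p.2)%N) f p.1 p.2.

Lemma eq_pair_sum f g :
  (forall a b : 'I_n, (a < b)%N -> f a b = g a b) -> pair_sum f = pair_sum g.
Proof. by move=> fg; apply: eq_bigr => -[a b] /= ltab; apply: fg. Qed.

Lemma pair_sumD f g : pair_sum (fun a b => f a b + g a b) = pair_sum f + pair_sum g.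
Proof. exact: big_split. Qed.

Lemma pair_sum0 f : (forall a b, a != b -> f a b = 0) -> pair_sum f = 0.
Proof.
by move=> f0; apply: big1 => -[a b] /= ltab; apply: f0; rewrite -val_eqE ltn_eqF.
Qed.

Lemma pair_sum_swap f :
  pair_sum (fun a b => f b a) = \sum_(p : 'I_n * 'I_n | (p.2 < p.1)%N) f p.1 p.2.
Proof.
rewrite /pair_sum (reindex_inj (h := fun p : 'I_n * 'I_n => (p.2, p.1))) //=.
by move=> [a b] [c d] [-> ->].
Qed.

Lemma pair_sum_double f :
  pair_sum (fun a b => f a b + f b a) = \sum_a \sum_(b | b != a) f a b.
Proof.
rewrite pair_sumD (pair_sum_swap f) /pair_sum pair_big_dep /=.
rewrite [RHS](bigID (fun p : 'I_n * 'I_n => (p.1 < p.2)%N)) /=; congr (_ + _).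
  by apply: eq_bigl => -[a b] /=; rewrite -val_eqE /=; case: ltngtP.
by apply: eq_bigl => -[a b] /=; rewrite -val_eqE /=; case: ltngtP.
Qed.

Lemma sym_double_sum f : (forall a b, f a b = f b a) ->
  \sum_a \sum_b f a b = \sum_a f a a.
Proof.
move=> fC; rewrite (eq_bigr (fun a => f a a + \sum_(b | b != a) f a b)).
  rewrite big_split /= -pair_sum_double [X in _ + X]pair_sum0 ?addr0 //.
  by move=> a b _; rewrite [f b a]fC ch2.
by move=> a _; rewrite (bigD1 a).
Qed.

(** Replacing the natural order by another tournament only reverses some pairs;
    for a symmetric summand in characteristic 2 it changes nothing. *)
Lemma tournament_sum (e : rel 'I_n) f :
    (forall a b, a != b -> e b a = ~~ e a b) -> (forall a, e a a = false) ->
  \sum_(p : 'I_n * 'I_n | e p.1 p.2) f p.1 p.2 =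
  pair_sum f + pair_sum (fun a b => if e b a then f a b + f b a else 0).
Proof.
move=> eN e0.
have neq (a b : 'I_n) : (a < b)%N -> a != b by move=> ?; rewrite -val_eqE ltn_eqF.
rewrite -pair_sumD (bigID (fun p : 'I_n * 'I_n => (p.1 < p.2)%N)) /=.
have -> : \sum_(p : 'I_n * 'I_n | e p.1 p.2 && ~~ (p.1 < p.2)%N) f p.1 p.2 =
          pair_sum (fun a b => if e b a then f b a else 0).
  rewrite (pair_sum_swap (fun a b => if e a b then f a b else 0)) -big_mkcondr /=.
  apply: eq_bigl => -[a b] /=; rewrite andbC -leqNgt leq_eqVlt.
  by case: eqP => //= /val_inj ->; rewrite e0 ltnn.
rewrite /pair_sum big_mkcondl /= -big_split /=; apply: eq_bigr => -[a b] /= ltab.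
rewrite (eN b a) ?[b == a]eq_sym ?neq //; case: (e b a) => //=.
by rewrite add0r addrA ch2 add0r.
Qed.

Lemma pair_sum_permE (s : 'S_n) f :
  pair_sum (fun a b => f (s a) (s b)) =
  pair_sum f +
  pair_sum (fun a b => if ((s^-1)%g b < (s^-1)%g a)%N then f a b + f b a else 0).
Proof.
rewrite -(@tournament_sum (fun a b => (s^-1)%g a < (s^-1)%g b)%N); first last.
- by move=> a; rewrite ltnn.
- move=> a b neq; rewrite -leqNgt ltn_neqAle andbC.
  by case: leqP => //= _; rewrite val_eqE (inj_eq perm_inj) eq_sym.
rewrite /pair_sum [RHS](reindex_inj (h := fun p : 'I_n * 'I_n => (s p.1, s p.2))) /=.
  by apply: eq_bigl => p; rewrite !permK.
by move=> [a b] [c d] [/perm_inj -> /perm_inj ->].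
Qed.

Lemma pair_sum_perm (s : 'S_n) f : (forall a b, f a b = f b a) ->
  pair_sum (fun a b => f (s a) (s b)) = pair_sum f.
Proof.
move=> fC; rewrite pair_sum_permE [X in _ + X]pair_sum0 ?addr0 // => a b _.
by case: ifP => // _; rewrite [f b a]fC ch2.
Qed.
End PairSum.

(** * Kronecker products *)

Section Tensor.
Variable F : fieldType.

Lemma tprodDl m1 n1 (A A' : 'M[F]_(m1, n1)) m2 n2 (B : 'M_(m2, n2)) :
  tprod (A + A') B = tprod A B + tprod A' B.
Proof.
elim: m1 A A' => [|m1 IH] A A' /=; first by rewrite addr0.
by rewrite !linearD /= IH -!trowbE linearD /= add_col_mx.
Qed.

Lemma tprodDr m1 n1 (A : 'M[F]_(m1, n1)) m2 n2 (B B' : 'M_(m2, n2)) :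
  tprod A (B + B') = tprod A B + tprod A B'.
Proof.
elim: m1 A => [|m1 IH] A /=; first by rewrite addr0.
by rewrite IH linearD /= add_col_mx.
Qed.

Lemma mxtrace_mul_eq0 n (A : 'M[F]_n) : (forall B, \tr (A *m B) = 0) -> A = 0.
Proof.
move=> trA; apply/matrixP=> i j; rewrite mxE -(trA (delta_mx j i)).
rewrite /mxtrace (bigD1 i) //= big1 => [|k ki].
  rewrite addr0 mxE (bigD1 j) //= big1 => [|l lj].
    by rewrite mxE !eqxx mulr1 addr0.
  by rewrite mxE (negPf lj) mulr0.
by rewrite mxE big1 // => l _; rewrite mxE (negPf ki) andbF mulr0.
Qed.

(** The trace of a Kronecker product is multiplicative, and the trace form is
    nondegenerate on each factor. *)
Lemma tprod_eq0 n1 n2 (A : 'M[F]_n1) (B : 'M[F]_n2) :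
  tprod A B = 0 -> A = 0 \/ B = 0.
Proof.
move=> AB0; case: (eqVneq A 0) => [|A_neq0]; [by left | right].
apply: mxtrace_mul_eq0 => N.
have trAB M : \tr (A *m M) * \tr (B *m N) = 0.
  by rewrite -mxtrace_prod tprodE AB0 mul0mx mxtrace0.
case: (eqVneq (\tr (B *m N)) 0) => // trB; case/eqP: A_neq0.
apply: mxtrace_mul_eq0 => M; apply/eqP.
by move/eqP: (trAB M); rewrite mulf_eq0 (negPf trB) orbF.
Qed.
End Tensor.

(** * Derivations into a matrix algebra *)

Section Inner.
Variables (F : fieldType) (gT : finGroupType) (G : {group gT}) (d : nat).
Variable rG : mx_representation F G d.

(** The trace condition says that Delta is compatible with the trace form, so it
    vanishes on linear relations between the matrices rG s and extends to a
    derivation L of the whole matrix algebra, spanned by these matrices. A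
    derivation of a matrix algebra is inner: R = sum_i L(E_i0) E_0i. *)
Lemma traceless_derivation_inner (Delta : gT -> 'M[F]_d) :
    mx_absolutely_irreducible rG ->
    {in G &, forall s t, Delta (s * t)%g = Delta s *m rG t + rG s *m Delta t} ->
    {in G, forall s, \tr (Delta s) = 0} ->
  exists R, {in G, forall s, Delta s = R *m rG s - rG s *m R}.
Proof.
move=> /mx_abs_irrP[d_gt0 [a aE]] DeltaM trDelta.
(* Delta respects the linear relations between the rG x. *)
have wd (c : gT -> F) :
    \sum_(x in G) c x *: rG x = 0 -> \sum_(x in G) c x *: Delta x = 0.
  move=> c0; apply: mxtrace_mul_eq0 => B; rewrite [B]aE mulmx_sumr linear_sum /=.
  rewrite big1 // => y Gy; rewrite -scalemxAr linearZ /= mulmx_suml.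
  rewrite (eq_bigr (fun x => c x *: Delta (x * y)%g - c x *: rG x *m Delta y)).
    rewrite sumrB raddfB /= -mulmx_suml c0 mul0mx linear0 subr0 linear_sum /= big1 ?mulr0 //.
    by move=> x Gx; rewrite linearZ /= trDelta ?mulr0 ?groupM.
  by move=> x Gx; rewrite DeltaM // scalerDr -!scalemxAl addrK.
(* The extension of Delta to all matrices. *)
pose L A := \sum_(x in G) a x A *: Delta x.
have wdL c A : \sum_(x in G) c x *: rG x = A -> \sum_(x in G) c x *: Delta x = L A.
  move=> cA; apply/eqP; rewrite -subr_eq0 -sumrB.
  rewrite (eq_bigr (fun x => (c x - a x A) *: Delta x)) => [|x _]; last by rewrite scalerBl.
  apply/eqP/wd; rewrite (eq_bigr _ (fun x _ => scalerBl _ _ _)) sumrB cA -aE.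
  exact: subrr.
have LD I (r : seq I) (k : I -> F) (A : I -> 'M_d) :
    L (\sum_(i <- r) k i *: A i) = \sum_(i <- r) k i *: L (A i).
  rewrite -(wdL (fun x => \sum_(i <- r) k i * a x (A i))).
    rewrite (eq_bigr _ (fun x _ => scaler_suml _ _ _ _)) exchange_big /=.
    apply: eq_bigr => i _; rewrite scaler_sumr.
    by apply: eq_bigr => x _; rewrite scalerA.
  rewrite (eq_bigr _ (fun x _ => scaler_suml _ _ _ _)) exchange_big /=.
  apply: eq_bigr => i _; rewrite {2}[A i]aE scaler_sumr.
  by apply: eq_bigr => x _; rewrite scalerA.
have LM s A : s \in G -> L (rG s *m A) = Delta s *m A + rG s *m L A.
  move=> Gs; rewrite -(wdL (fun x => a (s^-1 * x)%g A)).
    rewrite (reindex_inj (mulgI s)) /= {2}[A]aE !mulmx_sumr -big_split /=.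
    apply: eq_big => x; rewrite ?groupMl // => Gx.
    by rewrite mulKg DeltaM // -!scalemxAr scalerDr.
  rewrite (reindex_inj (mulgI s)) /= {2}[A]aE mulmx_sumr.
  by apply: eq_big => x; rewrite ?groupMl // => Gx; rewrite mulKg -scalemxAr repr_mxM.
pose o := Ordinal d_gt0.
exists (\sum_i L (delta_mx i o) *m delta_mx o i) => s Gs.
apply: (canRL (addrK _)); rewrite mulmx_sumr mulmx_suml.
have sum1 : \sum_(i < d) delta_mx i o *m delta_mx o i = 1%:M :> 'M[F]_d.
  by rewrite mx1_sum_delta; apply: eq_bigr => i _; rewrite mul_delta_mx.
rewrite -[Delta s]mulmx1 -sum1 mulmx_sumr -big_split /=.
rewrite (eq_bigr (fun i => \sum_j (rG s j i *: L (delta_mx j o)) *m delta_mx o i)).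
  rewrite exchange_big /=; apply: eq_bigr => j _; rewrite -[in RHS]mulmxA.
  have -> : delta_mx o j *m rG s = \sum_i rG s j i *: delta_mx o i.
    rewrite {1}[rG s]matrix_sum_delta mulmx_sumr (bigD1 j) //= mulmx_sumr.
    rewrite [X in _ + X]big1 ?addr0 => [|k kj].
      by apply: eq_bigr => i _; rewrite -scalemxAr mul_delta_mx.
    rewrite mulmx_sumr big1 // => l _.
    by rewrite -scalemxAr mul_delta_mx_0 ?scaler0 // eq_sym.
  by rewrite mulmx_sumr; apply: eq_bigr => i _; rewrite -scalemxAl scalemxAr.
move=> i _; rewrite !mulmxA -mulmxDl -LM // -mulmx_suml -LD; congr (L _ *m _).
rewrite {1}(matrix_sum_delta (rG s)) mulmx_suml; apply: eq_bigr => j _.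
rewrite mulmx_suml (bigD1 i) //= -scalemxAl mul_delta_mx.
rewrite big1 ?addr0 // => k ki.
by rewrite -scalemxAl mul_delta_mx_0 ?scaler0.
Qed.
End Inner.

(** * Traces in characteristic 2 *)

Section Char2.
Variables (F : fieldType) (F2 : 2%N \in [pchar F]).

Lemma addmx_pchar2 m n (A : 'M[F]_(m, n)) : A + A = 0.
Proof. by apply/matrixP=> i j; rewrite !mxE addrr_pchar2. Qed.

Lemma addmx_pchar2_eq m n (A B : 'M[F]_(m, n)) : A + B = 0 -> A = B.
Proof. by move=> AB; rewrite -[A]addr0 -(addmx_pchar2 B) addrA AB add0r. Qed.

Lemma mxtrace_sqr d (A : 'M[F]_d) : \tr (A *m A) = \tr A ^+ 2.
Proof.
rewrite expr2 /mxtrace mulr_suml.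
rewrite (eq_bigr (fun i => \sum_j A i j * A j i)) => [|i _]; last by rewrite mxE.
rewrite [RHS](eq_bigr (fun i => \sum_j A i i * A j j)) => [|i _]; last first.
  by rewrite mulr_sumr.
by rewrite !sym_double_sum // => *; rewrite ?addrr_pchar2 // mulrC.
Qed.

Lemma mxtrace_nilpotent d (A : 'M[F]_d) k : A ^+ k = 0 -> \tr A = 0.
Proof.
move=> Ak0; have trX m : \tr (A ^+ (2 ^ m)) = \tr A ^+ (2 ^ m).
  elim: m => [|m IH]; first by rewrite !expr1.
  by rewrite expnSr !exprM -IH -mxtrace_sqr expr2.
have /eqP : \tr A ^+ (2 ^ k) = 0.
  by rewrite -trX -(subnK (ltnW (ltn_expl k (ltnSn 1)))) exprD Ak0 mulr0 mxtrace0.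
by rewrite expf_eq0 => /andP[_ /eqP].
Qed.

End Char2.

(** * Transpositions and inversion cocycles *)

Section Rep.
Variables (F : fieldType) (n d : nat).
Variable rho : mx_representation F [set: 'S_n]%G d.

Definition transp (a b : 'I_n) : 'M[F]_d := rho (tperm a b).
Definition dtransp (a b : 'I_n) : 'M[F]_d := 1%:M + transp a b.

Definition four_cycle (a b c e : 'I_n) : 'M[F]_d :=
  transp a b + transp b c + transp c e + transp e a.

Lemma rhoM s t : rho (s * t)%g = rho s *m rho t.
Proof. by rewrite repr_mxM ?inE. Qed.

Lemma transpC a b : transp a b = transp b a. Proof. by rewrite /transp tpermC. Qed.
Lemma dtranspC a b : dtransp a b = dtransp b a. Proof. by rewrite /dtransp transpC. Qed.

Lemma transpJ a b (s : 'S_n) : transp a b *m rho s = rho s *m transp (s a) (s b).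
Proof. by rewrite -!rhoM conjgC tpermJ. Qed.

Lemma dtranspJ a b (s : 'S_n) : dtransp a b *m rho s = rho s *m dtransp (s a) (s b).
Proof. by rewrite mulmxDl mulmxDr transpJ mul1mx mulmx1. Qed.

Lemma transp_id a : transp a a = 1%:M. Proof. by rewrite /transp tperm1 repr_mx1. Qed.

Lemma transpK a b : transp a b *m transp a b = 1%:M.
Proof. by rewrite -rhoM tperm2 repr_mx1. Qed.

Hypothesis F2 : 2%N \in [pchar F].
Let ch2 (A : 'M[F]_d) := addmx_pchar2 F2 A.

Lemma dtransp_id a : dtransp a a = 0. Proof. by rewrite /dtransp transp_id ch2. Qed.

Lemma dtranspK a b : dtransp a b *m dtransp a b = 0.
Proof. by rewrite mulmxDl mulmxDr !mul1mx mulmxDr mulmx1 transpK [transp a b + _]addrC ch2. Qed.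

(** Indexed by inversions of s^-1, which suits the convention that permutations
    act on the right: conjugation by rho s sends dtransp a b to
    dtransp (s a) (s b). *)
Definition inversion_sum (s : 'S_n) : 'M[F]_d :=
  pair_sum (fun a b => if ((s^-1)%g b < (s^-1)%g a)%N then dtransp a b else 0).

Lemma pair_sum_mulr (A : 'M[F]_d) (f : 'I_n -> 'I_n -> 'M_d) :
  pair_sum f *m A = pair_sum (fun a b => f a b *m A).
Proof. exact: mulmx_suml. Qed.

Lemma pair_sum_mull (A : 'M[F]_d) (f : 'I_n -> 'I_n -> 'M_d) :
  A *m pair_sum f = pair_sum (fun a b => A *m f a b).
Proof. exact: mulmx_sumr. Qed.

(** The cocycle identity: in characteristic 2 a pair inverted twice contributes
    nothing. *)
Lemma inversion_sumM s t :
  inversion_sum s *m rho t + rho t *m inversion_sum t = rho t *m inversion_sum (s * t).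
Proof.
pose f a b := if ((s * t)^-1%g b < (s * t)^-1%g a)%N then dtransp a b else 0.
have -> : inversion_sum s *m rho t = rho t *m pair_sum (fun a b => f (t a) (t b)).
  rewrite pair_sum_mulr pair_sum_mull; apply: eq_pair_sum => a b _.
  by rewrite /f invMg !permM !permK; case: ifP => _; rewrite ?dtranspJ ?mul0mx ?mulmx0.
rewrite (pair_sum_permE ch2) -mulmxDr -addrA; congr (_ *m _).
suff -> : pair_sum (fun a b => if ((t^-1)%g b < (t^-1)%g a)%N then f a b + f b a else 0) =
  inversion_sum t by rewrite ch2 addr0.
apply: eq_pair_sum => a b ltab; case: ifP => // _; rewrite /f [dtransp b a]dtranspC.
case: ltngtP => [_|_|]; rewrite ?addr0 ?add0r // => /val_inj /perm_inj eab.
by rewrite eab ltnn in ltab.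
Qed.

(** The conjugates u_k of dtransp a b by the powers of s belong to pairs that are
    equal or disjoint, hence they commute; u_i = u_0 since s^i swaps a and b. So
    the power i.+1 of rho s *m dtransp a b has u_0 twice as a factor and
    vanishes: the product is nilpotent. *)
Lemma trace_swapped_pair (s : 'S_n) a b i :
    a != b -> (s ^+ i)%g a = b -> (s ^+ i)%g b = a ->
  \tr (rho s *m dtransp a b) = 0.
Proof.
move=> neq_ab sia sib.
pose u k := dtransp ((s ^+ k)%g a) ((s ^+ k)%g b).
have u0 : u 0%N = dtransp a b by rewrite /u expg0 !perm1.
have uJ k : u k *m rho s = rho s *m u k.+1 by rewrite dtranspJ -!permM -!expgSr.
have uX k : dtransp a b *m (rho s : 'M_d) ^+ k = (rho s : 'M_d) ^+ k *m u k.
  elim: k => [|k IH]; first by rewrite expr0 [_ *m 1]mulmx1 [1 *m _]mul1mx u0.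
  by rewrite exprSr [_ *m (_ * _)]mulmxA IH -mulmxA uJ mulmxA.
have comm k : u 0%N *m u k = u k *m u 0%N.
  have swapi x : (s ^+ k)%g ((s ^+ i)%g x) = (s ^+ i)%g ((s ^+ k)%g x).
    by rewrite -!permM -!expgD addnC.
  have sak : (s ^+ k)%g a = (s ^+ i)%g ((s ^+ k)%g b) by rewrite -swapi sib.
  have sbk : (s ^+ k)%g b = (s ^+ i)%g ((s ^+ k)%g a) by rewrite -swapi sia.
  rewrite u0 /u; case: (eqVneq ((s ^+ k)%g a) a) => [eaa | neq_aa].
    by rewrite sbk eaa sia.
  case: (eqVneq ((s ^+ k)%g a) b) => [eab | neq_ab'].
    by rewrite sbk eab sib [dtransp b a]dtranspC.
  have neq_ba : (s ^+ k)%g b != a by apply: contraNneq neq_ab' => e; rewrite sak e sia.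
  have neq_bb : (s ^+ k)%g b != b by apply: contraNneq neq_aa => e; rewrite sak e sib.
  rewrite !(mulmxDl, mulmxDr) !mul1mx !mulmx1.
  by rewrite [transp a b *m _]transpJ !tpermD // addrACA.
have expS (A : 'M[F]_d) m : A ^+ m.+1 = A *m A ^+ m by exact: exprS.
have sX m : exists2 Y,
    (rho s *m dtransp a b) ^+ m.+1 = (rho s : 'M_d) ^+ m.+1 *m Y & u 0%N *m Y = 0.
  elim: m => [|m [Y XY uY]]; first by exists (dtransp a b); rewrite ?expr1 // u0 dtranspK.
  exists (u m.+1 *m Y); last by rewrite mulmxA comm -mulmxA uY mulmx0.
  rewrite [LHS]expS XY [in RHS]expS -[LHS]mulmxA [dtransp a b *m _]mulmxA uX.
  by rewrite -!mulmxA.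
apply: (mxtrace_nilpotent F2 (k := i.+1)).
case: i sia sib => [|i] sia sib.
  by rewrite expg0 perm1 in sia; rewrite sia eqxx in neq_ab.
have [Y XY uY] := sX i.
rewrite expS XY -mulmxA [dtransp a b *m _]mulmxA uX -(mulmxA _ (u _)).
by rewrite /u sia sib dtranspC -u0 uY !mulmx0.
Qed.

(** Let phi a b be the trace of rho s *m dtransp a b, a function constant on the
    orbits of s on pairs. Pairs swapped by a power of s have phi = 0. The other
    pairs can be oriented in an s-invariant way, here by comparing the ranks of
    the orbits O a b and O b a of ordered pairs. Measured against this
    orientation, the inversions of s are a difference of the form
    k(p) + k(s^-1 p), whose weighted sum with phi is zero. *)
Lemma trace_inversion_sum (s : 'S_n) : \tr (rho s *m inversion_sum s) = 0.
Proof.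
have F2' (x : F) : x + x = 0 by exact: addrr_pchar2.
pose phi a b := \tr (rho s *m dtransp a b).
have phiC a b : phi a b = phi b a by rewrite /phi dtranspC.
have phiJ a b : phi (s a) (s b) = phi a b by rewrite /phi -dtranspJ mxtrace_mulC.
pose O a b := [set ((x : 'S_n) a, x b) | x in <[s]>%g].
have OJ a b : O (s a) (s b) = O a b.
  apply/setP=> p; apply/imsetP/imsetP => -[x sx ->].
    by exists (s * x)%g; rewrite ?permM // groupM ?cycle_id.
  by exists (s^-1 * x)%g; rewrite ?permM ?permK // groupM ?groupV ?cycle_id.
pose e a b := (enum_rank (O a b) < enum_rank (O b a))%N.
have eC a b : phi a b != 0 -> a != b -> e b a = ~~ e a b.
  move=> phi0 neq_ab; rewrite /e -leqNgt ltn_neqAle andbC val_eqE.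
  rewrite (inj_eq enum_rank_inj); case: eqP => [Oab|]; last by rewrite andbT.
  have: (b, a) \in O a b.
    by rewrite -Oab; apply/imsetP; exists 1%g; rewrite ?group1 ?perm1.
  case/imsetP=> x /cycleP[i ->{x}] [sib sia]; case/eqP: phi0.
  exact: (trace_swapped_pair (i := i)).
pose f (a b : 'I_n) := if (a < b)%N (+) e a b then phi a b else 0.
have fC a b : f a b = f b a.
  rewrite /f [phi b a]phiC.
  case: (eqVneq (phi a b) 0) => [->|phi0]; first by rewrite !if_same.
  case: (eqVneq a b) => [-> //|neq]; rewrite (eC a b) //.
  case: ltngtP => [_|_|/val_inj ab]; [by case: (e a b).. | by rewrite ab eqxx in neq].
rewrite pair_sum_mull /pair_sum linear_sum /=.
rewrite (_ : \sum_(p | _) _ =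
  pair_sum f + pair_sum (fun a b => f ((s^-1)%g a) ((s^-1)%g b))).
  by rewrite (pair_sum_perm F2').
rewrite -pair_sumD; apply: eq_bigr => -[a b] /= ltab.
have phiV : phi ((s^-1)%g a) ((s^-1)%g b) = phi a b by rewrite -phiJ !permKV.
have eV : e ((s^-1)%g a) ((s^-1)%g b) = e a b.
  by rewrite /e -[O (_ a) _]OJ -[O (_ b) _]OJ !permKV.
rewrite /f phiV eV ltab /=; case: ltngtP => [_|_|/val_inj /perm_inj eab].
- by rewrite -/(phi a b); case: (e a b); rewrite /= ?addr0 ?add0r.
- by rewrite mulmx0 mxtrace0; case: (e a b); rewrite /= ?addr0 ?F2'.
- by rewrite eab ltnn in ltab.
Qed.

Lemma inversion_sum_coboundary : mx_absolutely_irreducible rho ->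
  exists R, forall s, R *m rho s = rho s *m (R + inversion_sum s).
Proof.
move=> abs_rho.
have [||R RE] :=
  traceless_derivation_inner (Delta := fun s => rho s *m inversion_sum s) abs_rho.
- move=> s t _ _; rewrite -!mulmxA rhoM -mulmxA -inversion_sumM mulmxDr.
  by congr (_ + _); rewrite !mulmxA.
- by move=> s _; apply: trace_inversion_sum.
by exists R => s; rewrite mulmxDr RE ?inE // addrC subrK.
Qed.

Lemma comm_transp_comm (A : 'M[F]_d) :
    (forall a b, transp a b *m A = A *m transp a b) ->
  forall s, rho s *m A = A *m rho s.
Proof.
move=> cA s; have [ts -> _] := prod_tpermP s.
elim/big_rec: _ => [|[a b] x _ IH] /=; first by rewrite repr_mx1 mul1mx mulmx1.
by rewrite rhoM -mulmxA IH mulmxA cA mulmxA.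
Qed.
End Rep.

(** * Irreducible modules *)

Lemma fresh_letter n (r : seq 'I_n) : (size r < n)%N -> exists x, x \notin r.
Proof.
move=> lt_r; apply/existsP; apply: contraLR lt_r; rewrite negb_exists -leqNgt.
move/forallP=> all_r; rewrite -[n in (n <= _)%N]card_ord; apply: leq_trans (card_size r).
by apply/subset_leq_card/subsetP=> x _; move: (all_r x); rewrite negbK.
Qed.

Lemma perm_map_uniq n (r1 r2 : seq 'I_n) : uniq r1 -> uniq r2 -> size r1 = size r2 ->
  exists s : 'S_n, map s r1 = r2.
Proof.
elim: r1 r2 => [|x r1 IH] [|y r2] //=; first by exists 1%g.
move=> /andP[xr1 u1] /andP[yr2 u2] [eq_sz]; have [s sr] := IH r2 u1 u2 eq_sz.
exists (s * tperm (s x) y)%g; rewrite permM tpermL; congr (_ :: _).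
rewrite -[RHS]sr; apply/eq_in_map => z zr1; rewrite permM tpermD //.
  by rewrite (inj_eq perm_inj); apply: contraNneq xr1 => ->.
by apply: contraNneq yr2 => ->; rewrite -sr map_f.
Qed.

Section Irr.
Variables (F : closedFieldType) (F2 : 2%N \in [pchar F]) (n d : nat).
Variable rho : mx_representation F [set: 'S_n]%G d.
Hypothesis irr : mx_irreducible rho.
Let ch2 (A : 'M[F]_d) := addmx_pchar2 F2 A.
Notation tau := (transp rho).

Lemma abs_irr : mx_absolutely_irreducible rho.
Proof. exact: group_closure_closed_field. Qed.

Lemma schur (A : 'M[F]_d) : (forall s, rho s *m A = A *m rho s) -> is_scalar_mx A.
Proof.
by move=> cA; apply: (mx_abs_irr_cent_scalar abs_irr); apply/centgmxP=> s _; rewrite cA.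
Qed.

Lemma scalar_rep_linear : (forall s, is_scalar_mx (rho s)) -> (d <= 1)%N.
Proof.
move=> sc; rewrite leqNgt; apply/negP=> d_gt1.
have /mx_abs_irrP[d_gt0 [a aE]] := abs_irr.
pose i0 := Ordinal d_gt0; pose i1 := Ordinal d_gt1.
have /matrixP/(_ i0 i1)/eqP := aE (delta_mx i0 i1).
rewrite mxE !eqxx summxE big1 ?oner_eq0 // => s _.
by have /is_scalar_mxP[x ->] := sc s; rewrite !mxE mulr0.
Qed.

Lemma rho_can s (A B : 'M[F]_d) : rho s *m A = rho s *m B -> A = B.
Proof.
move=> eqAB; rewrite -[A]mul1mx -[B]mul1mx -(repr_mx1 rho) -(mulVg s).
by rewrite rhoM -!mulmxA eqAB.
Qed.

(** Conjugation spreads the equality to all triples, so that all transpositions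
    act by the same operator, which is then central. *)
Lemma equal_transp_linear a b c : uniq [:: a; b; c] -> tau a b = tau b c -> (d <= 1)%N.
Proof.
move=> u_abc eq_abc.
have eq3 x y z : uniq [:: x; y; z] -> tau x y = tau y z.
  move=> u_xyz; have [s [sa sb sc]] := perm_map_uniq u_abc u_xyz erefl.
  by apply: (@rho_can s); rewrite -sa -sb -sc -!transpJ eq_abc.
have const x y : x != y -> tau x y = tau a b.
  have eqb z : z != b -> tau b z = tau a b.
    case: (eqVneq z a) => [-> _|za zb]; first by rewrite transpC.
    rewrite -(eq3 a b z) //=; move: u_abc; rewrite /= !inE !negb_or !andbT.
    by case/andP=> /andP[-> _] _; rewrite /= eq_sym za eq_sym zb.
  case: (eqVneq x b) => [-> | xb]; first by rewrite eq_sym; apply: eqb.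
  case: (eqVneq y b) => [-> _| yb xy]; first by rewrite transpC eqb.
  by rewrite -(eq3 b x y) ?eqb //= !inE !negb_or xy eq_sym xb eq_sym yb.
have tau_scalar x y : is_scalar_mx (tau x y).
  case: (eqVneq x y) => [-> | xy]; first by rewrite transp_id scalar_mx_is_scalar.
  apply/schur/comm_transp_comm => u v; rewrite [RHS]transpJ.
  by rewrite (const x y) // (const (tperm u v x)) ?(inj_eq perm_inj).
apply: scalar_rep_linear => s; have [ts -> _] := prod_tpermP s.
elim/big_rec: _ => [|[x y] w _ /is_scalar_mxP[k kw]] /=.
  by rewrite repr_mx1 scalar_mx_is_scalar.
have /is_scalar_mxP[l lxy] := tau_scalar x y.
by rewrite rhoM kw -/(tau x y) lxy -scalar_mxM scalar_mx_is_scalar.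
Qed.

(** The sum of the two 3-cycles on a, b, c. *)
Definition bracket a b c := tau a b *m tau b c + tau b c *m tau a b.

Lemma transp_braid a b c : uniq [:: a; b; c] ->
  tau a b *m tau b c *m tau a b = tau a c /\ tau b c *m tau a b *m tau b c = tau a c.
Proof.
rewrite /= !inE !negb_or !andbT => /andP[/andP[ab ac] bc]; split.
  rewrite -mulmxA [tau b c *m _]transpJ tpermR tpermD // ?mulmxA ?transpK ?mul1mx //.
rewrite -mulmxA [tau a b *m _]transpJ tpermL tpermD 1?eq_sym //.
by rewrite mulmxA transpK mul1mx.
Qed.

Lemma comm_transp_linear a b c : uniq [:: a; b; c] -> bracket a b c = 0 -> (d <= 1)%N.
Proof.
move=> u_abc /(addmx_pchar2_eq F2) comm; apply: (equal_transp_linear u_abc).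
have [e1 e2] := transp_braid u_abc.
rewrite comm -mulmxA transpK mulmx1 in e1.
by rewrite -comm -mulmxA transpK mulmx1 in e2; rewrite e1 e2.
Qed.

Lemma bracket_sqr a b c : (tau a b + tau b c) *m (tau a b + tau b c) = bracket a b c.
Proof.
rewrite mulmxDl !mulmxDr !transpK [_ *m tau a b + 1%:M]addrC addrACA ch2 add0r.
by [].
Qed.

Lemma bracketJ a b c s : bracket a b c *m rho s = rho s *m bracket (s a) (s b) (s c).
Proof.
rewrite mulmxDl mulmxDr -!mulmxA (transpJ _ b c s) (transpJ _ a b s) !mulmxA.
by rewrite (transpJ _ a b s) (transpJ _ b c s).
Qed.

(** A 3-cycle and its inverse are the squares of each other. *)
Lemma bracket_idem a b c : uniq [:: a; b; c] ->
  bracket a b c *m bracket a b c = bracket a b c.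
Proof.
move=> u_abc; have [e1 e2] := transp_braid u_abc.
have xK := transpK rho a b; have yK := transpK rho b c.
move: e1 e2 xK yK; rewrite /bracket.
move: (tau a b) (tau b c) (tau a c) => x y z e1 e2 xK yK.
have -> : (x *m y + y *m x) *m (x *m y + y *m x) =
          (x *m y *m x *m y + y *m (x *m x) *m y) + (x *m (y *m y) *m x + y *m x *m y *m x).
  by rewrite mulmxDl !mulmxDr !mulmxA addrACA [X in _ + X]addrC addrACA.
have zy : z *m y = y *m x by rewrite -e2 -mulmxA yK mulmx1.
have zx : z *m x = x *m y by rewrite -e1 -mulmxA xK mulmx1.
by rewrite e1 e2 zy zx xK yK !mulmx1 xK yK -addrA (addrA 1%:M) ch2 add0r addrC.
Qed.

Lemma bracketC a b c : bracket a b c = bracket c b a.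
Proof. by rewrite /bracket addrC ![tau b _]transpC ![tau _ b]transpC. Qed.

Lemma bracketCA a b c : uniq [:: a; b; c] -> bracket a b c = bracket b a c.
Proof.
move=> u_abc; have [e1 e2] := transp_braid u_abc.
rewrite /bracket -e1 [tau b a]transpC addrC.
congr (_ + _); rewrite ?mulmxA ?transpK ?mul1mx //.
by rewrite -!mulmxA transpK mulmx1.
Qed.

Hypothesis d_gt1 : (1 < d)%N.
Hypothesis four_cycle0 : forall a b c e, uniq [:: a; b; c; e] ->
  four_cycle rho a b c e = 0.

(** Under the vanishing of four-cycles both brackets are the square of
    tau a b + tau b c = tau a e + tau e c. *)
Lemma bracket_mid a b c e : uniq [:: a; b; c; e] -> bracket a b c = bracket a e c.
Proof.
move=> u; rewrite -!bracket_sqr (_ : tau a b + tau b c = tau a e + tau e c) //.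
apply: (addmx_pchar2_eq F2); rewrite [tau a e + _]addrC addrA.
by rewrite [tau e c]transpC [tau a e]transpC -/(four_cycle _ _ _ _ _) four_cycle0.
Qed.

Lemma bracket_left a b c e : uniq [:: a; b; c; e] -> bracket a b c = bracket e b c.
Proof.
rewrite /= !inE !negb_or !andbT => /and3P[/and3P[ab ac ae] /andP[bc be] ce].
rewrite (@bracketCA a b c) ?(@bracketCA e b c) ?(@bracket_mid b a c e) //= !inE !negb_or.
- by rewrite [b == a]eq_sym ab bc be ac ae ce.
- by rewrite [e == b]eq_sym be [e == c]eq_sym ce bc.
- by rewrite ab ac bc.
Qed.

Lemma bracket_tpermL a b c y : uniq [:: a; b; c] -> a != y ->
  bracket (tperm a y a) (tperm a y b) (tperm a y c) = bracket a b c.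
Proof.
move=> u ay; have := u; rewrite tpermL /= !inE !negb_or !andbT => /andP[/andP[ab ac] bc].
case: (eqVneq y b) => [->|yb].
  by rewrite tpermR tpermD //; symmetry; apply: bracketCA.
case: (eqVneq y c) => [->|yc].
  by rewrite tpermR tpermD 1?[c == b]eq_sym // bracketC.
rewrite !tpermD //; symmetry; apply: bracket_left.
by rewrite /= !inE !negb_or ab ac ay bc [b == y]eq_sym yb [c == y]eq_sym yc.
Qed.

Lemma bracket_tperm x y a b c : x != y -> uniq [:: a; b; c] -> x \in [:: a; b; c] ->
  bracket (tperm x y a) (tperm x y b) (tperm x y c) = bracket a b c.
Proof.
have img (s : 'S_n) r : uniq (map s r) = uniq r by exact/map_inj_uniq/perm_inj.
move=> xy u; rewrite !inE => /or3P[]/eqP ex; subst x; first exact: bracket_tpermL.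
  have u' : uniq [:: b; a; c].
    move: u; rewrite /= !inE !negb_or [b == a]eq_sym => /and3P[/andP[-> ->] ->] //.
  rewrite [RHS]bracketCA // -(bracket_tpermL u' xy); apply: bracketCA.
  by rewrite (img _ [:: a; b; c]).
rewrite bracketC [RHS]bracketC bracket_tpermL //.
by rewrite -(rev_uniq).
Qed.

(** Any letter of the triple may be exchanged for any other letter. *)
Lemma bracket_scalar a b c : uniq [:: a; b; c] -> is_scalar_mx (bracket a b c).
Proof.
move=> u; apply/schur/comm_transp_comm => x y; rewrite [RHS]bracketJ; congr (_ *m _).
case: (eqVneq x y) => [->|xy]; first by rewrite tperm1 !perm1.
case: (boolP (x \in [:: a; b; c])) => [x_in|]; first by rewrite bracket_tperm.
case: (boolP (y \in [:: a; b; c])) => [y_in _|].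
  by rewrite tpermC bracket_tperm // eq_sym.
rewrite !inE !negb_or => /and3P[ya yb yc] /and3P[xa xb xc].
by rewrite !tpermD.
Qed.

(** The bracket is an idempotent scalar. If it were 0 the transpositions would
    commute and the module would be linear; so it is 1, and the braid relation
    turns tau a c into tau a b + tau b c. *)
Lemma spin_relations a b c : uniq [:: a; b; c] ->
  bracket a b c = 1%:M /\ tau a b + tau b c = tau a c.
Proof.
move=> u; have /is_scalar_mxP[k bk] := bracket_scalar u.
have /eqP : k%:M = (k ^+ 2)%:M :> 'M[F]_d by rewrite expr2 scalar_mxM -bk bracket_idem.
have d_gt0 := ltnW d_gt1; pose i0 := Ordinal d_gt0.
move/eqP/matrixP/(_ i0 i0)/eqP; rewrite !mxE !eqxx !mulr1n eq_sym -subr_eq0.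
rewrite expr2 -{3}[k]mulr1 -mulrBr mulf_eq0 subr_eq0 => /orP[]/eqP k01.
  have := comm_transp_linear u; rewrite bk k01 raddf0 => /(_ erefl).
  by rewrite leqNgt d_gt1.
have b1 : bracket a b c = 1%:M by rewrite bk k01.
split=> //; have [<- _] := transp_braid u.
move: b1; rewrite /bracket => b1.
have -> : tau a b *m tau b c = 1%:M + tau b c *m tau a b.
  by rewrite -b1 -addrA ch2 addr0.
by rewrite mulmxDl mul1mx -mulmxA transpK mulmx1.
Qed.
End Irr.

(** * Irreducible tensor products *)

(** What is used of the Kronecker product. The abstraction makes the two factors
    interchangeable: tprod A B and tprod B A are both instances. *)
Record tensor_like (F : fieldType) d1 d2 N (ten : 'M[F]_d1 -> 'M[F]_d2 -> 'M[F]_N) : Prop :=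
  TensorLike {
    tenDl : forall A A' B, ten (A + A') B = ten A B + ten A' B;
    tenDr : forall A B B', ten A (B + B') = ten A B + ten A B';
    tenM : forall A A' B B', ten A B *m ten A' B' = ten (A *m A') (B *m B');
    ten_eq0 : forall A B, ten A B = 0 -> A = 0 \/ B = 0 }.

Section Product.
Variables (F : closedFieldType) (F2 : 2%N \in [pchar F]) (n d1 d2 N : nat).
Variables (rho1 : mx_representation F [set: 'S_n]%G d1)
          (rho2 : mx_representation F [set: 'S_n]%G d2)
          (T : mx_representation F [set: 'S_n]%G N).
Variable ten : 'M[F]_d1 -> 'M[F]_d2 -> 'M[F]_N.
Hypotheses (tenP : tensor_like ten) (TE : forall s, T s = ten (rho1 s) (rho2 s)).
Hypothesis irrT : mx_irreducible T.
Hypothesis d1_gt0 : (0 < d1)%N.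

Let Dl := tenDl tenP.
Let Dr := tenDr tenP.
Let tM := tenM tenP.
Let ch2 m1 m2 (A : 'M[F]_(m1, m2)) := addmx_pchar2 F2 A.
Notation tau1 := (transp rho1).
Notation tau2 := (transp rho2).
Notation nu2 := (dtransp rho2).

Lemma ten0l B : ten 0 B = 0.
Proof. by apply: (@addrI _ (ten 0 B)); rewrite -Dl !addr0. Qed.

Lemma ten0r A : ten A 0 = 0.
Proof. by apply: (@addrI _ (ten A 0)); rewrite -Dr !addr0. Qed.

Lemma ten_suml (I : Type) (r : seq I) (P : pred I) (A : I -> 'M[F]_d1) B :
  ten (\sum_(i <- r | P i) A i) B = \sum_(i <- r | P i) ten (A i) B.
Proof. by elim/big_rec2: _ => [|i X Y _ <-]; rewrite ?ten0l ?Dl. Qed.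

Lemma ten_sumr (I : Type) (r : seq I) (P : pred I) A (B : I -> 'M[F]_d2) :
  ten A (\sum_(i <- r | P i) B i) = \sum_(i <- r | P i) ten A (B i).
Proof. by elim/big_rec2: _ => [|i X Y _ <-]; rewrite ?ten0r ?Dr. Qed.

Lemma ten_mulrn A B k : ten (A *+ k) B = ten A (B *+ k).
Proof. by elim: k => [|k IH]; rewrite ?ten0l ?ten0r // !mulrS Dl Dr IH. Qed.

Lemma ten1_eq0 B : ten 1%:M B = 0 -> B = 0.
Proof.
case/(ten_eq0 tenP) => // /matrixP/(_ (Ordinal d1_gt0) (Ordinal d1_gt0))/eqP.
by rewrite !mxE eqxx oner_eq0.
Qed.

Lemma pair_sum_scalar (f : 'I_n -> 'I_n -> 'M[F]_N) :
    (forall a b, f a b = f b a) ->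
    (forall s a b, f a b *m T s = T s *m f (s a) (s b)) ->
  is_scalar_mx (pair_sum f).
Proof.
move=> fC fJ; apply: (schur irrT) => s.
rewrite pair_sum_mulr -(pair_sum_perm (@ch2 _ _) s fC) pair_sum_mull.
by apply: eq_pair_sum => a b _; rewrite fJ.
Qed.

(** For a pair i, j the sum h i j of the conjugates of tau1 i j under the
    four-group generated by (a c) and (b e) vanishes by doubling, unless one
    letter lies in {a, c} and the other in {b, e}; in that case the conjugates
    are the four edges of the cycle a, b, c, e. *)
Lemma four_cycle_ten a b c e : uniq [:: a; b; c; e] ->
  ten (four_cycle rho1 a b c e) (four_cycle rho2 a b c e) = 0.
Proof.
rewrite /= !inE !negb_or !andbT => /and3P[/and3P[ab ac ae] /andP[bc be] ce].
pose W (s : 'S_n) := pair_sum (fun i j => ten (tau1 (s i) (s j)) (tau2 i j)).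
have [k Wk] : exists k, forall s, W s = k%:M.
  have /is_scalar_mxP[k kE] : is_scalar_mx (pair_sum (fun i j => ten (tau1 i j) (tau2 i j))).
    apply: pair_sum_scalar => [i j|s i j]; first by rewrite transpC [tau2 i j]transpC.
    by rewrite TE !tM !transpJ.
  exists k => s; have one : ten 1%:M 1%:M = 1%:M by rewrite -(repr_mx1 T) TE !repr_mx1.
  rewrite -[W s]mul1mx -one -{1}(repr_mx1 rho1) -(mulVg s) rhoM.
  rewrite -[X in ten _ X]mul1mx -tM -mulmxA.
  have -> : ten (rho1 s) 1%:M *m W s = k%:M *m ten (rho1 s) 1%:M.
    rewrite -kE pair_sum_mulr pair_sum_mull; apply: eq_pair_sum => i j _.
    by rewrite !tM transpJ mul1mx mulmx1.
  by rewrite mulmxA scalar_mxC -mulmxA tM -rhoM mulVg repr_mx1 mul1mx one mulmx1.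
pose p := tperm a c; pose q := tperm b e.
pose h i j := tau1 i j + tau1 (p i) (p j) +
  (tau1 (q i) (q j) + tau1 ((q * p)%g i) ((q * p)%g j)).
have h0 : pair_sum (fun i j => ten (h i j) (tau2 i j)) = 0.
  transitivity (W 1%g + W p + (W q + W (q * p)%g)); last by rewrite !Wk !ch2.
  rewrite -!pair_sumD; apply: eq_pair_sum => i j _.
  by rewrite /h !Dl !perm1.
pose inA i := i \in [:: a; c]; pose inB i := i \in [:: b; e].
have AB i : inA i -> ~~ inB i.
  rewrite /inA /inB !inE negb_or => /orP[]/eqP->; first by rewrite ab.
  by rewrite [c == b]eq_sym bc.
pose g i j := if inA i && inB j then tau2 i j else 0.
have h_cross i j : inA i -> inB j -> h i j = four_cycle rho1 a b c e.
  have pE : [/\ p a = c, p c = a, p b = b & p e = e].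
    by rewrite /p tpermL tpermR !tpermD // eq_sym.
  have qE : [/\ q b = e, q e = b, q a = a & q c = c].
    by rewrite /q tpermL tpermR !tpermD // eq_sym.
  case: pE qE => pa pc pb pe [qb qe qa qc].
  have -> : four_cycle rho1 a b c e = tau1 a b + tau1 c b + (tau1 a e + tau1 c e).
    by rewrite /four_cycle [tau1 b c]transpC [tau1 e a]transpC -!addrA [X in _ + (_ + X)]addrC.
  rewrite /h /inA /inB !permM !inE => /orP[]/eqP-> /orP[]/eqP->;
    rewrite ?(pa, pb, pc, pe, qa, qb, qc, qe) //.
  - by rewrite addrC.
  - by rewrite [X in X + _]addrC [X in _ + X]addrC.
  - by rewrite [LHS]addrC [X in X + _]addrC [X in _ + X]addrC.
have hC i j : h i j = h j i.
  by rewrite /h; congr (_ + _ + (_ + _)); apply: transpC.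
have h_out i j : ~~ (inA i && inB j) -> ~~ (inB i && inA j) -> h i j = 0.
  have pN x : ~~ inA x -> p x = x.
    by rewrite /inA !inE negb_or => /andP[xa xc]; rewrite /p tpermD // eq_sym.
  have qN x : ~~ inB x -> q x = x.
    by rewrite /inB !inE negb_or => /andP[xb xe]; rewrite /q tpermD // eq_sym.
  have qA x : ~~ inA x -> ~~ inA (q x).
    case: (boolP (inB x)) => [Bx _|/qN-> //]; apply/negP=> /AB/negP[].
    by move: Bx; rewrite /inB !inE => /orP[]/eqP->; rewrite /q ?tpermL ?tpermR eqxx ?orbT.
  move=> nAB nBA; rewrite /h !permM.
  case: (boolP (inA i || inA j)) => [Aij|].
    have nB : ~~ inB i /\ ~~ inB j.
      case/orP: Aij => [Ai|Aj].
        by split; [apply: AB | move: nAB; rewrite Ai].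
      by split; [move: nBA; rewrite Aj andbT | apply: AB].
    by rewrite !qN ?nB.1 ?nB.2 // ch2.
  by rewrite negb_or => /andP[nAi nAj]; rewrite !pN ?qA // !ch2.
have hg i j : i != j ->
    ten (h i j) (tau2 i j) = ten (four_cycle rho1 a b c e) (g i j + g j i).
  move=> neq; rewrite /g [inA j && _]andbC.
  case: (boolP (inA i && inB j)) => [/andP[Ai Bj]|nAB].
    by rewrite h_cross // (negPf (AB i Ai)) addr0.
  case: (boolP (inB i && inA j)) => [/andP[Bi Aj]|nBA].
    by rewrite hC h_cross // add0r transpC.
  by rewrite h_out // addr0 ten0l ten0r.
pose gg i j := ten (four_cycle rho1 a b c e) (g i j + g j i).
rewrite -[RHS]h0 [RHS](eq_pair_sum (g := gg)).
  transitivity (ten (four_cycle rho1 a b c e) (pair_sum (fun i j => g i j + g j i)));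
    last by rewrite /pair_sum ten_sumr.
  rewrite pair_sum_double; congr (ten _ _).
  transitivity (\sum_(i <- [:: a; c]) \sum_(j <- [:: b; e]) tau2 i j).
    rewrite !big_cons !big_nil !addr0 /four_cycle [tau2 b c]transpC [tau2 e a]transpC.
    by rewrite -!addrA; congr (_ + _); rewrite addrA addrC.
  rewrite big_uniq /=; last by rewrite !inE ac.
  rewrite big_mkcond; apply: eq_bigr => i _; rewrite /g /inA.
  case: ifP => Ai; last by rewrite big1.
  rewrite big_uniq /=; last by rewrite !inE be.
  rewrite big_mkcond [RHS]big_mkcond; apply: eq_bigr => j _.
  case: (eqVneq j i) => //= ->; by have := AB i Ai; rewrite /inB => /negPf ->.
by move=> i j ltij; apply: hg; rewrite -val_eqE ltn_eqF.
Qed.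

Lemma even_mulrn (V : zmodType) (x : V) k : x + x = 0 -> ~~ odd k -> x *+ k = 0.
Proof. by move=> x2 /even_halfK <-; rewrite -mul2n mulrnA mulr2n x2 mul0rn. Qed.

Lemma pair_sum_const (V : zmodType) (x : V) : pair_sum (fun _ _ : 'I_n => x) = x *+ 'C(n, 2).
Proof.
transitivity (\sum_(a < n) \sum_(b < n | (a < b)%N) x); first by rewrite pair_big_dep.
rewrite (exchange_big_dep xpredT) //= -bin2_sum big_mkord -sumrMnr.
apply: eq_bigr => b _; rewrite -(big_ord_widen n (fun _ => x) (ltnW (ltn_ord b))).
by rewrite sumr_const card_ord.
Qed.

(** From here on the first factor is a basic spin module, and o is the last
    letter. *)
Hypothesis spin1 : forall a b c, uniq [:: a; b; c] ->
  bracket rho1 a b c = 1%:M /\ tau1 a b + tau1 b c = tau1 a c.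
Hypothesis irr1 : mx_irreducible rho1.
Hypothesis irr2 : mx_irreducible rho2.
Hypotheses (n_even : ~~ odd n) (n_choose_2_even : ~~ odd 'C(n, 2)).
Variable o : 'I_n.
Hypothesis o_max : forall i : 'I_n, (i <= o)%N.

(** Clifford generators based at o; the value 0 at o makes transp_cliff hold for
    all pairs. *)
Definition cliff a := if a == o then 0 else tau1 a o.
Notation c := cliff.

Lemma transp_cliff a b : a != b -> tau1 a b = c a + c b.
Proof.
rewrite /c; case: (eqVneq a o) => [->|ao] ab.
  by rewrite eq_sym in ab; rewrite add0r (negPf ab) transpC.
case: (eqVneq b o) => [->|bo]; first by rewrite addr0.
have u : uniq [:: a; o; b] by rewrite /= !inE !negb_or ao ab eq_sym bo.
by have [_ <-] := spin1 u; rewrite [tau1 o b]transpC.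
Qed.

Lemma cliff_anticomm a b :
  c a *m c b + c b *m c a = 1%:M *+ [&& a != o, b != o & a != b].
Proof.
rewrite /c; case: (eqVneq a o) => [_|ao]; first by rewrite mul0mx mulmx0 addr0 mulr0n.
case: (eqVneq b o) => [_|bo]; first by rewrite mul0mx mulmx0 addr0 mulr0n.
case: (eqVneq a b) => [->|ab]; first by rewrite ch2 mulr0n.
have u : uniq [:: a; o; b] by rewrite /= !inE !negb_or ao ab eq_sym bo.
by have [<- _] := spin1 u; rewrite /bracket [tau1 o b]transpC.
Qed.

Lemma cliff_sqr a : c a *m c a = 1%:M *+ (a != o).
Proof. by rewrite /c; case: eqVneq; rewrite ?transpK ?mul0mx. Qed.

Lemma cliffJ a s : c a *m rho1 s = rho1 s *m (c (s a) + c (s o)).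
Proof.
rewrite {1}/c; case: (eqVneq a o) => [->|ao]; first by rewrite mul0mx ch2 mulmx0.
by rewrite transpJ transp_cliff // (inj_eq perm_inj).
Qed.

(** The sum w is invariant because n is even, hence scalar. Expanding the sum of
    the C(n,2) squares (c a + c b)^2 = 1 gives w^2, so w is 0 when C(n,2) is
    even. *)
Lemma sum_cliff0 : \sum_a c a = 0.
Proof.
set w := \sum_a c a.
have /is_scalar_mxP[k wk] : is_scalar_mx w.
  apply: (schur irr1) => s; rewrite mulmx_suml (eq_bigr _ (fun a _ => cliffJ a s)).
  rewrite -mulmx_sumr big_split /= sumr_const card_ord even_mulrn ?ch2 // addr0.
  by rewrite /w [in LHS](reindex_inj (@perm_inj _ s)).
have : w *m w = 0.
  transitivity (pair_sum (fun a b => tau1 a b *m tau1 a b)).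
    pose g a b := c a *m c a + c a *m c b.
    transitivity (\sum_a \sum_(b | b != a) g a b); last first.
      rewrite -pair_sum_double; apply: eq_pair_sum => a b ltab.
      rewrite transp_cliff -?val_eqE ?ltn_eqF // /g mulmxDl !mulmxDr.
      by rewrite -!addrA; congr (_ + (_ + _)); rewrite addrC.
    transitivity (\sum_a \sum_b g a b); last first.
      by apply: eq_bigr => a _; rewrite (bigD1 a) //= /g ch2 add0r.
    rewrite /w mulmx_suml; apply: eq_bigr => a _.
    by rewrite big_split /= sumr_const card_ord even_mulrn ?ch2 // add0r mulmx_sumr.
  rewrite (eq_pair_sum (g := fun _ _ => 1%:M)) => [|a b _]; last by rewrite transpK.
  by rewrite pair_sum_const even_mulrn ?ch2.
rewrite wk -scalar_mxM => /matrixP/(_ (Ordinal d1_gt0) (Ordinal d1_gt0))/eqP.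
by rewrite !mxE eqxx mulf_eq0 orbb => /eqP->; rewrite raddf0.
Qed.

(** Taking the commutator with c k replaces c a by 1, except for a = o and a = k. *)
Lemma star_scalar (G : 'I_n -> 'M[F]_d2) :
    is_scalar_mx (\sum_a ten (c a) (G a)) ->
  forall k, k != o -> \sum_(a | (a != o) && (a != k)) G a = 0.
Proof.
case/is_scalar_mxP=> x Sx k ko; apply: ten1_eq0.
transitivity ((\sum_a ten (c a) (G a)) *m ten (c k) 1%:M +
              ten (c k) 1%:M *m (\sum_a ten (c a) (G a))); last first.
  by rewrite Sx scalar_mxC ch2.
rewrite mulmx_suml mulmx_sumr -big_split /= ten_sumr big_mkcond /=; apply: eq_bigr => a _ /=.
rewrite !tM mulmx1 mul1mx -Dl cliff_anticomm ko.
by rewrite ten_mulrn /=; case: (a != o); case: (a != k); rewrite ?ten0r.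
Qed.

Definition row_sum a := \sum_b nu2 a b.

Lemma row_sumJ a s : row_sum a *m rho2 s = rho2 s *m row_sum (s a).
Proof.
rewrite mulmx_suml mulmx_sumr [RHS](reindex_inj (@perm_inj _ s)).
by apply: eq_bigr => b _; rewrite dtranspJ.
Qed.

Lemma pair_sum_row_sum (A : 'I_n -> 'M[F]_d1) :
  pair_sum (fun a b => ten (A a) (nu2 a b) + ten (A b) (nu2 a b)) =
  \sum_a ten (A a) (row_sum a).
Proof.
transitivity (pair_sum (fun a b => ten (A a) (nu2 a b) + ten (A b) (nu2 b a))).
  by apply: eq_pair_sum => a b _; rewrite [nu2 b a]dtranspC.
rewrite (pair_sum_double (fun a b => ten (A a) (nu2 a b))); apply: eq_bigr => a _.
by rewrite ten_sumr [RHS](bigD1 a) //= dtransp_id // ten0r add0r.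
Qed.

Hypothesis n_gt2 : (2 < n)%N.

(** The invariant sum of tau1 a b (x) nu2 a b is the sum of c a (x) row_sum a;
    star_scalar then determines row_sum off o, and a transposition moves the
    equality to o. *)
Lemma row_sum_const a b : row_sum a = row_sum b.
Proof.
have S_scalar : is_scalar_mx (\sum_a ten (c a) (row_sum a)).
  rewrite -pair_sum_row_sum (eq_pair_sum (g := fun a b => ten (tau1 a b) (nu2 a b))).
    apply: pair_sum_scalar => [x y|s x y]; first by rewrite transpC dtranspC.
    by rewrite TE !tM transpJ dtranspJ.
  by move=> x y ltxy; rewrite -Dl transp_cliff // -val_eqE ltn_eqF.
have off_o x : x != o -> row_sum x = \sum_(y | y != o) row_sum y.
  by move=> xo; rewrite [RHS](bigD1 x) //= (star_scalar S_scalar) // addr0.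
suff o_off x : x != o -> row_sum o = row_sum x.
  case: (eqVneq a o) => [->|ao]; case: (eqVneq b o) => [->|bo] //; try exact: o_off.
    by symmetry; apply: o_off.
  by rewrite (off_o a) ?(off_o b).
move=> xo; have [y] := @fresh_letter n [:: x; o] n_gt2; rewrite !inE negb_or => /andP[yx yo].
have exy : row_sum x = row_sum y by rewrite (off_o x) ?(off_o y).
apply: (@rho_can F n d2 rho2 (tperm x o)); transitivity (row_sum x *m rho2 (tperm x o)).
  by rewrite row_sumJ tpermL.
by rewrite exy row_sumJ tpermD // eq_sym.
Qed.

Variable R : 'M[F]_d2.
Hypothesis RE : forall s, R *m rho2 s = rho2 s *m (R + inversion_sum rho2 s).

(** The double sum alone depends on the order of the letters; R absorbs this
    dependence. *)
Definition theta : 'M[F]_N :=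
  pair_sum (fun a b => ten (c a *m c b) (nu2 a b)) + ten 1%:M R.

(** Conjugation by s sends c a to c (s a) + k with k = c (s o), so theta_comm needs
    the products of shifted generators. *)
Lemma cliff_shift_mul a b s (k := c (s o)) :
  (c a + k) *m (c b + k) =
  c a *m c b + (c a *m k + c b *m k) + 1%:M *+ ((b == o) + (b == s o)).
Proof.
rewrite mulmxDl !mulmxDr -!addrA; do 2![congr (_ + _)].
have -> : k *m c b = c b *m k + 1%:M *+ [&& b != o, s o != o & b != s o].
  by rewrite -cliff_anticomm addrA ch2 add0r.
rewrite -addrA cliff_sqr -mulrnDr; congr (_ + _).
case: (eqVneq b o) => [->|bo] /=.
  by rewrite add0n [o == _]eq_sym; case: eqP => //= _; rewrite mulr2n ch2.
case: (eqVneq (s o) o) => [->|so] /=; first by rewrite (negPf bo).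
by case: (b == s o) => //=; rewrite mulr2n ch2.
Qed.

Lemma cliff_shift_swap a b s (k := c (s o)) : a != b ->
  (c a + k) *m (c b + k) + (c b + k) *m (c a + k) =
  1%:M *+ [&& a != s o & b != s o].
Proof.
move=> ab; rewrite /k; case: (eqVneq a (s o)) => [->|ao] /=.
  by rewrite ch2 mul0mx mulmx0 addr0.
case: (eqVneq b (s o)) => [->|bo] /=.
  by rewrite ch2 mul0mx mulmx0 addr0.
have u : uniq [:: a; s o; b] by rewrite /= !inE !negb_or ao ab eq_sym bo.
rewrite -!transp_cliff //; have [<- _] := spin1 u.
by rewrite /bracket [tau1 (s o) b]transpC.
Qed.

(** After conjugation by s the double sum runs over shifted generators, in the
    order transported by s. The shift contributes the sum of all c a, which is
    zero, and the terms called ends at the letters o and s o; the change of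
    order contributes last_pair, the inversions avoiding s o. As o is the last
    letter, every pair (s o, b) with b after s o is inverted, and the constancy
    of row_sum shows that ends accounts for exactly the missing inversions. *)
Lemma theta_comm s : theta *m T s = T s *m theta.
Proof.
pose k := c (s o).
pose P a b := ten ((c a + k) *m (c b + k)) (nu2 a b).
have PJ : pair_sum (fun a b => ten (c a *m c b) (nu2 a b)) *m T s =
          T s *m pair_sum (fun a b => P (s a) (s b)).
  rewrite pair_sum_mulr pair_sum_mull; apply: eq_pair_sum => a b _.
  rewrite TE !tM dtranspJ; congr (ten _ _).
  by rewrite -[LHS]mulmxA (cliffJ b s) [LHS]mulmxA (cliffJ a s) -[LHS]mulmxA.
have RJ : ten 1%:M R *m T s = T s *m (ten 1%:M R + ten 1%:M (inversion_sum rho2 s)).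
  by rewrite TE -Dr !tM RE mul1mx mulmx1.
rewrite /theta mulmxDl PJ RJ -mulmxDr; congr (_ *m _).
rewrite (pair_sum_permE (@ch2 _ _) s P) [ten 1%:M R + _]addrC addrA; congr (_ + _).
pose inv (a b : 'I_n) := ((s^-1)%g b < (s^-1)%g a)%N.
pose last_pair a b : 'M[F]_d2 := if inv a b && [&& a != s o & b != s o] then nu2 a b else 0.
pose ends a b : 'M[F]_d2 := nu2 a b *+ ((b == o) + (b == s o)).
have swapE : pair_sum (fun a b => if inv a b then P a b + P b a else 0) =
             ten 1%:M (pair_sum last_pair).
  rewrite /pair_sum ten_sumr; apply: eq_bigr => -[a b] /= ltab; rewrite /last_pair.
  case: (inv a b) => /=; last by rewrite ten0r.
  have ab : a != b by rewrite -val_eqE ltn_eqF.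
  rewrite /P [nu2 b a]dtranspC -Dl cliff_shift_swap //.
  by rewrite ten_mulrn; case: ifP => _.
have PE : pair_sum P =
    pair_sum (fun a b => ten (c a *m c b) (nu2 a b)) + ten 1%:M (pair_sum ends).
  transitivity (pair_sum (fun a b => ten (c a *m c b) (nu2 a b)) +
      pair_sum (fun a b => ten (c a *m k) (nu2 a b) + ten (c b *m k) (nu2 a b)) +
      ten 1%:M (pair_sum ends)).
    rewrite /pair_sum ten_sumr -!big_split; apply: eq_bigr => -[a b] /= _.
    rewrite /P cliff_shift_mul !Dl /ends -/k; congr (_ + _).
    by rewrite ten_mulrn.
  rewrite pair_sum_row_sum (eq_bigr (fun a => ten (c a *m k) (row_sum o))) => [|a _].
    by rewrite -ten_suml -mulmx_suml sum_cliff0 mul0mx ten0l addr0.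
  by rewrite (row_sum_const a o).
rewrite PE swapE -!addrA -!Dr [X in ten _ X](_ : _ = 0) ?ten0r ?addr0 //.
rewrite -/(pair_sum _) /inversion_sum -!pair_sumD.
pose r x := pair_sum (fun a b => nu2 a b *+ ((b == x) + (a == x))).
have rE x : r x = row_sum x.
  transitivity (pair_sum (fun a b => nu2 a b *+ (a == x) + nu2 b a *+ (b == x))).
    by apply: eq_pair_sum => a b _; rewrite [nu2 b a]dtranspC -mulrnDr addnC.
  rewrite (pair_sum_double (fun a b => nu2 a b *+ (a == x))) (bigD1 x) //= [X in _ + X]big1 ?addr0.
    rewrite [RHS](bigD1 x) //= dtransp_id // add0r; apply: eq_bigr => b _.
    by rewrite eqxx.
  by move=> a /negPf ax; rewrite big1 // => b _; rewrite ax.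
transitivity (r o + r (s o)); last by rewrite !rE (row_sum_const o (s o)) ch2.
rewrite -pair_sumD; apply: eq_pair_sum => a b ltab.
have ao : a != o by rewrite -val_eqE neq_ltn (leq_trans ltab (o_max b)).
rewrite -mulrnDr (negPf ao) addn0 /ends /last_pair -/(inv a b).
case: (eqVneq b (s o)) => [bo|bo].
  have -> : inv a b = false by rewrite /inv bo permK ltnNge o_max.
  have -> : (a == s o) = false by rewrite -bo -val_eqE ltn_eqF.
  by rewrite /= !addr0 addn0.
case: (eqVneq a (s o)) => [eao|nao].
  have -> : inv a b = true.
    rewrite /inv eao permK ltn_neqAle o_max andbT val_eqE.
    by rewrite -(inj_eq (@perm_inj _ s)) permKV.
  by rewrite /= add0r addn0 mulrnDr.
by rewrite andbT /= !addn0; case: (inv a b); rewrite ch2 addr0.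
Qed.

Lemma theta_scalar : is_scalar_mx theta.
Proof. by apply: (schur irrT) => s; rewrite theta_comm. Qed.

(** The commutator of theta with c k is the sum of c a (x) G a, and star_scalar
    removes the remaining generator by commuting with c l. *)
Lemma theta_triangle k l : uniq [:: k; o; l] -> nu2 o k + nu2 l o + nu2 l k = 0.
Proof.
rewrite /= !inE !negb_or !andbT => /andP[/andP[ko kl] ol].
have lo : l != o by rewrite eq_sym.
pose G a := row_sum o + nu2 a o + nu2 a k.
have GS : \sum_a ten (c a) (G a) = 0.
  have /is_scalar_mxP[x tx] := theta_scalar.
  transitivity (theta *m ten (c k) 1%:M + ten (c k) 1%:M *m theta); last first.
    by rewrite tx scalar_mxC ch2.
  rewrite /theta mulmxDl mulmxDr !tM !mul1mx !mulmx1 addrACA ch2 addr0.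
  rewrite pair_sum_mulr pair_sum_mull -pair_sumD.
  pose eta b := (b != o) && (b != k).
  transitivity
    (pair_sum (fun a b => ten (c a) (nu2 a b *+ eta b) + ten (c b) (nu2 b a *+ eta a))).
    rewrite pair_sum_double; apply: eq_bigr => a _; rewrite -ten_sumr; congr (ten _ _).
    rewrite /G (row_sum_const o a) /row_sum (bigD1 o) //= (bigD1 k) //=.
    rewrite -addrA [nu2 a o + (nu2 a k + _)]addrA [X in X + _]addrC -addrA ch2 addr0.
    rewrite [LHS]big_mkcond [RHS]big_mkcond; apply: eq_bigr => b _ /=; rewrite -/(eta b).
    by case: (eqVneq b a) => [->|_]; case: (eta _); rewrite ?dtransp_id.
  apply: eq_pair_sum => a b ltab; rewrite !tM mul1mx mulmx1 -Dl [nu2 b a]dtranspC -!ten_mulrn -Dl.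
  have eta_cc y : c k *m c y = c y *m c k + 1%:M *+ eta y.
    have := cliff_anticomm y k; rewrite ko /= => <-.
    by rewrite addrA ch2 add0r.
  congr (ten _ _); rewrite mulmxA eta_cc mulmxDl -mulmxA -mulmxA eta_cc.
  rewrite mulmxDr !addrA ch2 add0r; congr (_ + _).
    by case: (eta b); rewrite ?mulmx1 ?mulmx0.
  by case: (eta a); rewrite ?mul1mx ?mul0mx.
have G0 : is_scalar_mx (\sum_a ten (c a) (G a)) by rewrite GS; apply: mx0_is_scalar.
have := star_scalar G0 lo; have sumG : \sum_a G a = 0.
  rewrite 2!big_split /= sumr_const card_ord even_mulrn ?ch2 // add0r.
  have sumC x : \sum_a nu2 a x = row_sum x by apply: eq_bigr => a _; rewrite dtranspC.
  by rewrite !sumC (row_sum_const o k) ch2.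
move=> rest0; rewrite -[RHS]sumG (bigD1 o) //= (bigD1 l) //= rest0 addr0 /G dtransp_id // addr0.
by rewrite -[row_sum o + nu2 l o + _]addrA [RHS]addrACA ch2 add0r addrA.
Qed.

Lemma theta_linear k l : uniq [:: k; o; l] -> (d2 <= 1)%N.
Proof.
move=> u; apply: (comm_transp_linear F2 irr2 u); rewrite -bracket_sqr //.
have -> : tau2 k o + tau2 o l = nu2 o k + nu2 l o.
  by rewrite /dtransp addrACA ch2 add0r transpC [tau2 o l]transpC.
by rewrite (addmx_pchar2_eq F2 (theta_triangle u)) dtranspK.
Qed.

End Product.

Section SpinFactor.
Variables (F : closedFieldType) (F2 : 2%N \in [pchar F]) (n d1 d2 N : nat).
Variables (rho1 : mx_representation F [set: 'S_n]%G d1)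
          (rho2 : mx_representation F [set: 'S_n]%G d2)
          (T : mx_representation F [set: 'S_n]%G N).
Variable ten : 'M[F]_d1 -> 'M[F]_d2 -> 'M[F]_N.

(** Four-transitivity of the symmetric group carries the vanishing to all quadruples. *)
Lemma vanishing_four_cycle_factor a b c e :
    tensor_like ten -> (forall s, T s = ten (rho1 s) (rho2 s)) ->
    mx_irreducible T -> mx_irreducible rho1 -> mx_irreducible rho2 -> (1 < d1)%N ->
    ~~ odd n -> ~~ odd 'C(n, 2) ->
    uniq [:: a; b; c; e] -> four_cycle rho1 a b c e = 0 ->
  (d2 <= 1)%N.
Proof.
move=> tenP TE irrT irr1 irr2 d1_gt1 n_even C_even u Q0.
have n_gt3 : (3 < n)%N.
  by have := max_card [in [:: a; b; c; e]]; rewrite card_ord (card_uniqP u).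
have Q0' x y z t : uniq [:: x; y; z; t] -> four_cycle rho1 x y z t = 0.
  move=> u'; have [s [<- <- <- <-]] := perm_map_uniq u u' erefl.
  apply: (@rho_can F n d1 rho1 s); rewrite mulmx0 !mulmxDr -!transpJ -!mulmxDl.
  by rewrite -/(four_cycle _ _ _ _ _) Q0 mul0mx.
have spin1 x y z := @spin_relations F F2 n d1 rho1 irr1 d1_gt1 Q0' x y z.
have n_gt0 : (0 < n)%N by apply: leq_trans n_gt3.
pose o : 'I_n := Ordinal (eq_ind_r (leq^~ n) (leqnn n) (prednK n_gt0)).
have o_max (i : 'I_n) : (i <= o)%N by rewrite /= -ltnS prednK.
have [k] := @fresh_letter n [:: o] (leq_trans (isT : (1 < 4)%N) n_gt3); rewrite !inE => ko.
have [l] := @fresh_letter n [:: k; o] (leq_trans (isT : (2 < 4)%N) n_gt3).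
rewrite !inE negb_or => /andP[lk lo].
have [R RE] := inversion_sum_coboundary F2 (abs_irr irr2).
apply: (theta_linear (o := o) (k := k) (l := l) F2 tenP TE irrT (ltnW d1_gt1)
  spin1 irr1 irr2 n_even C_even o_max _ RE).
  exact: leq_trans n_gt3.
by rewrite /= !inE !negb_or ko [k == l]eq_sym lk [o == l]eq_sym lo.
Qed.
End SpinFactor.

Theorem theorem1p2 (F : closedFieldType) (hF : 2%N \in [pchar F])
    (n m : nat) (hn : n = (2 * m)%N) (hm : ~~ odd m)
    (d1 d2 : nat)
    (D1 : mx_representation F [set: 'S_n]%G d1)
    (D2 : mx_representation F [set: 'S_n]%G d2)
    (irrD1 : mx_irreducible D1) (irrD2 : mx_irreducible D2)
    (hd1 : (1 < d1)%N) (hd2 : (1 < d2)%N) :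
  ~ mx_irreducible (prod_repr D1 D2).
Proof.
move=> irrT.
have n_even : ~~ odd n by rewrite hn oddM.
have C_even : ~~ odd 'C(n, 2).
  by rewrite bin2 hn -mulnA mul2n doubleK oddM negb_and hm.
have [r [ur sz_r]] : exists r : seq 'I_n, uniq r /\ size r = 4%N.
  exists (take 4 (enum 'I_n)); rewrite take_uniq ?enum_uniq // size_takel // size_enum_ord hn.
  case: m hm hn => [|[|m']] // _ n0; last by rewrite mulnC.
  suff : (d1 <= 1)%N by rewrite leqNgt hd1.
  apply: (scalar_rep_linear irrD1) => s.
  suff -> : s = 1%g by rewrite repr_mx1 scalar_mx_is_scalar.
  by apply/permP=> i; have := leq_trans (ltn_ord i) (eq_leq n0).
case: r ur sz_r => [|a [|b [|c [|e []]]]] // u _.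
have tenP : tensor_like (fun A : 'M[F]_d1 => tprod A (n2 := d2)).
  by split=> *; rewrite ?tprodDl ?tprodDr ?tprodE //; apply: tprod_eq0.
have tenP' : tensor_like (fun (B : 'M[F]_d2) (A : 'M[F]_d1) => tprod A B).
  split=> [||| A B /tprod_eq0[]->]; [| | |by right|by left];
  by move=> *; rewrite ?tprodDl ?tprodDr ?tprodE.
have TE s : prod_repr D1 D2 s = tprod (D1 s) (D2 s) by [].
case/(ten_eq0 tenP): (four_cycle_ten hF tenP TE irrT u) => Q0.
  have := vanishing_four_cycle_factor hF tenP TE irrT irrD1 irrD2 hd1 n_even C_even u Q0.
  by rewrite leqNgt hd2.
have := vanishing_four_cycle_factor hF tenP' TE irrT irrD2 irrD1 hd2 n_even C_even u Q0.
by rewrite leqNgt hd1.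
Qed.
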